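(* Let $G$ be a finite group, $k$ an algebraically closed field of characteristic zero, and $\omega$ a normalized $3$-cocycle on $G$ with values in $k^\times$. Let $K,H,K',H'$ be normal subgroups of $G$ such that $K$ and $H$ centralize each other and $K'$ and $H'$ centralize each other, and let $B:K\times H\to k^\times$ and $B':K'\times H'\to k^\times$ be $G$-invariant $\omega$-bicharacters. Then, as fusion subcategories of $\operatorname{Rep}(D^\omega(G))$, $\mathcal{S}(K,H,B)\subseteq\mathcal{S}(K',H',B')$ if and only if $K\subseteq K'$, $H'\subseteq H$, and $B|_{K\times H'}=B'|_{K\times H'}$.
   Context: A normalized 3-cocycle is a map $\omega:G^3\to k^\times$ with $\omega(g_2,g_3,g_4)\,\omega(g_1,g_2g_3,g_4)\,\omega(g_1,g_2,g_3)=\omega(g_1g_2,g_3,g_4)\,\omega(g_1,g_2,g_3g_4)$ and $\omega(g,e,l)=1$ ($e$ the identity of $G$). For $a,x,y\in G$ put $\beta_a(x,y)=\frac{\omega(a,x,y)\,\omega(x,y,y^{-1}x^{-1}axy)}{\omega(x,x^{-1}ax,y)}$ and $\gamma_a(x,y)=\frac{\omega(x,y,a)\,\omega(a,a^{-1}xa,a^{-1}ya)}{\omega(x,a,a^{-1}ya)}$. $D^\omega(G)$ is the Dijkgraaf--Pasquier--Roche quasi-triangular quasi-Hopf algebra with basis $\{\delta_g\overline{x}\}_{g,x\in G}$, product $(\delta_g\overline{x})(\delta_h\overline{y})=\beta_g(x,y)\,\delta_g\overline{xy}$ if $h=x^{-1}gx$ and $0$ otherwise, coproduct $\Delta(\delta_g\overline{x})=\sum_{hl=g}\gamma_x(h,l)\,\delta_h\overline{x}\otimes\delta_l\overline{x}$,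 associator $\sum\omega(g,h,l)^{-1}\delta_g\overline{e}\otimes\delta_h\overline{e}\otimes\delta_l\overline{e}$, and $R$-matrix $\sum_{g,h}\delta_g\overline{e}\otimes\delta_h\overline{g}$. $\operatorname{Rep}(D^\omega(G))$ (finite-dimensional modules) is a modular category, braided equivalent to the center of $\operatorname{Vec}_G^\omega$. Let $R$ be a set of representatives of the conjugacy classes of $G$. A $\beta_a$-character of $C_G(a)$ is the trace function of a finite-dimensional module over the twisted group algebra $k^{\beta_a}[C_G(a)]$ (basis $\overline{x}$, $\overline{x}\,\overline{y}=\beta_a(x,y)\overline{xy}$); $\deg\chi=\chi(e)$. Isomorphism classes of simple objects are identified with pairs $(a,\chi)$, $a\in R$, $\chi$ an irreducible $\beta_a$-character of $C_G(a)$: $(a,\chi)$ is the simple module $M$ with $\delta_a\overline{e}M\ne0$ on which $\operatorname{span}\{\delta_a\overline{x}:x\in C_G(a)\}\cong k^{\beta_a}[C_G(a)]$ acts on $\delta_a\overline{e}M$ with character $\chi$. For normal subgroups $K,H$ of $G$ that centralize each other (commute elementwise), $B:K\times H\to k^\times$ is an $\omega$-bicharacter if $B(x,yz)=\beta_x(y,z)^{-1}B(x,y)B(x,z)$ and $B(wx,y)=\beta_y(w,x)B(w,y)B(x,y)$ for all $w,x\in K$, $y,z\in H$; it is $G$-invariant if $B(x^{-1}kx,h)=\frac{\beta_k(x,h)\beta_k(xh,x^{-1})}{\beta_k(x,x^{-1})}B(k,xhx^{-1})$ for all $x\in G,k\in K,h\in H$. $\mathcal{S}(K,H,B)$ is the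 full subcategory of $\operatorname{Rep}(D^\omega(G))$ whose objects are the finite direct sums of simple objects $(a,\chi)$ with $a\in K\cap R$ and $\chi(h)=B(a,h)\deg\chi$ for all $h\in H$; it is a fusion subcategory. *)

(* Defs.v *)
From HB Require Import structures.
From mathcomp Require Import all_boot all_order all_algebra all_fingroup.
From mathcomp Require Import ring.

Set Implicit Arguments.
Unset Strict Implicit.
Unset Printing Implicit Defensive.

Import GRing.Theory.
Local Open Scope ring_scope.

(* A finite-dimensional unital algebra given by a basis b_i (i in tw_idx) and
   the product b_i b_j = c(i, j) b_(i.j), where (i, j) |-> i.j is associative
   and c may take the value 0; its unit is the sum of the b_i for i in a given
   set.  Both D^w(G) and the twisted group algebras are of this form. *)
Record twist (k : fieldType) := Twist {
  tw_idx : finType;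
  tw_op : tw_idx -> tw_idx -> tw_idx;
  tw_cst : tw_idx -> tw_idx -> k;
  tw_unit : {set tw_idx};
  tw_opA : associative tw_op;
  tw_cstA : forall i j l,
    tw_cst i j * tw_cst (tw_op i j) l = tw_cst j l * tw_cst i (tw_op j l);
  tw_1l : forall j l,
    \sum_(i in tw_unit) tw_cst i j * (tw_op i j == l)%:R = (j == l)%:R;
  tw_1r : forall j l,
    \sum_(i in tw_unit) tw_cst j i * (tw_op j i == l)%:R = (j == l)%:R;
  tw_unit_neq0 : tw_unit != set0 }.

(* An alias of the function space, hiding its pointwise ring structure. *)
Definition twalg (k : fieldType) (T : twist k) : Type := {ffun tw_idx T -> k^o}.

Section TwistedAlgebra.
Variables (k : fieldType) (T : twist k).
Local Notation I := (tw_idx T).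
Local Notation A := (twalg T).

HB.instance Definition _ := GRing.Lmodule.copy A {ffun I -> k^o}.

Definition tw_basis (i : I) : A := [ffun j => (i == j)%:R].
Definition twalg_one : A := [ffun j => (j \in tw_unit T)%:R].
Definition twalg_mul (u v : A) : A :=
  [ffun l => \sum_i \sum_j u i * v j * tw_cst i j * (tw_op i j == l)%:R].

Lemma sum_indic (J : finType) (F : J -> k) (i : J) :
  \sum_j (i == j)%:R * F j = F i.
Proof.
rewrite (bigD1 i) //= eqxx mul1r big1 ?addr0 // => j.
by rewrite eq_sym => /negPf->; rewrite mul0r.
Qed.

Lemma twalg_mulA : associative twalg_mul.
Proof.
move=> u v w; apply/ffunP => l; rewrite !ffunE; apply/esym.
transitivity (\sum_i \sum_j \sum_n u i * v j * w n *
   (tw_cst i j * tw_cst (tw_op i j) n) * (tw_op (tw_op i j) n == l)%:R).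
  transitivity (\sum_m \sum_n \sum_i \sum_j (tw_op i j == m)%:R *
     (u i * v j * tw_cst i j * w n * tw_cst m n * (tw_op m n == l)%:R)).
    apply: eq_bigr => m _; apply: eq_bigr => n _.
    rewrite ffunE !mulr_suml; apply: eq_bigr => i _.
    rewrite !mulr_suml; apply: eq_bigr => j _.
    by move: (u i : k) (v j : k) (w n : k) => a b c; ring.
  under eq_bigr do rewrite exchange_big /=.
  rewrite exchange_big /=; apply: eq_bigr => i _.
  under eq_bigr do rewrite exchange_big /=.
  rewrite exchange_big /=; apply: eq_bigr => j _.
  rewrite exchange_big /=; apply: eq_bigr => n _.
  rewrite sum_indic !mulrA; congr (_ * _ * _).
  by rewrite -!mulrA [tw_cst i j * _]mulrC.
transitivity (\sum_i \sum_m \sum_j \sum_n (tw_op j n == m)%:R *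
     (u i * v j * w n * tw_cst j n * tw_cst i m * (tw_op i m == l)%:R)); last first.
  apply: eq_bigr => i _; apply: eq_bigr => m _.
  rewrite ffunE mulr_sumr !mulr_suml; apply: eq_bigr => j _.
  rewrite mulr_sumr !mulr_suml; apply: eq_bigr => n _.
  by move: (u i : k) (v j : k) (w n : k) => a b c; ring.
apply: eq_bigr => i _.
rewrite [RHS]exchange_big /=; apply: eq_bigr => j _.
rewrite [RHS]exchange_big /=; apply: eq_bigr => n _.
by rewrite sum_indic tw_cstA tw_opA !mulrA.
Qed.

Lemma twalg_mul1l : left_id twalg_one twalg_mul.
Proof.
move=> u; apply/ffunP => l; rewrite ffunE exchange_big /=.
transitivity (\sum_j (l == j)%:R * (u j : k)); last exact: sum_indic.
apply: eq_bigr => j _.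
have ->: (l == j)%:R = (j == l)%:R :> k by rewrite eq_sym.
rewrite -tw_1l mulr_suml [RHS]big_mkcond /=.
apply: eq_bigr => i _; rewrite ffunE.
case: (i \in _); rewrite ?mul0r // mul1r -mulrA mulrC.
by rewrite -!mulrA.
Qed.

Lemma twalg_mul1r : right_id twalg_one twalg_mul.
Proof.
move=> u; apply/ffunP => l; rewrite ffunE.
transitivity (\sum_j (l == j)%:R * (u j : k)); last exact: sum_indic.
apply: eq_bigr => j _.
have ->: (l == j)%:R = (j == l)%:R :> k by rewrite eq_sym.
rewrite -tw_1r mulr_suml [RHS]big_mkcond /=.
apply: eq_bigr => i _; rewrite ffunE.
case: (i \in _); rewrite ?mulr0 ?mul0r // mulr1 -mulrA mulrC.
by rewrite -!mulrA.
Qed.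

Lemma twalg_mulDl : left_distributive twalg_mul +%R.
Proof.
move=> u v w; apply/ffunP => l; rewrite !ffunE -big_split; apply: eq_bigr => i _.
by rewrite -big_split; apply: eq_bigr => j _; rewrite ffunE !mulrDl.
Qed.

Lemma twalg_mulDr : right_distributive twalg_mul +%R.
Proof.
move=> u v w; apply/ffunP => l; rewrite !ffunE -big_split; apply: eq_bigr => i _.
by rewrite -big_split; apply: eq_bigr => j _; rewrite ffunE mulrDr !mulrDl.
Qed.

Lemma twalg_one_neq0 : twalg_one != 0.
Proof.
have /set0Pn[i Ui] := tw_unit_neq0 T.
by apply/eqP => /ffunP/(_ i)/eqP; rewrite !ffunE Ui oner_eq0.
Qed.

HB.instance Definition _ := GRing.Zmodule_isNzRing.Build A
  twalg_mulA twalg_mul1l twalg_mul1r twalg_mulDl twalg_mulDr twalg_one_neq0.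

Lemma twalg_scaleAl (a : k) (u v : A) : a *: (u * v) = (a *: u) * v.
Proof.
apply/ffunP => l; rewrite !ffunE scaler_sumr; apply: eq_bigr => i _.
by rewrite scaler_sumr; apply: eq_bigr => j _; rewrite ffunE /GRing.scale /= !mulrA.
Qed.

Lemma twalg_scaleAr (a : k) (u v : A) : a *: (u * v) = u * (a *: v).
Proof.
apply/ffunP => l; rewrite !ffunE scaler_sumr; apply: eq_bigr => i _.
rewrite scaler_sumr; apply: eq_bigr => j _.
by rewrite ffunE /GRing.scale /= !mulrA [a * _]mulrC.
Qed.

HB.instance Definition _ := GRing.Lmodule_isLalgebra.Build k A twalg_scaleAl.
HB.instance Definition _ := GRing.Lalgebra_isAlgebra.Build k A twalg_scaleAr.

Lemma tw_basisM i j : tw_basis i * tw_basis j = tw_cst i j *: tw_basis (tw_op i j).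
Proof.
apply/ffunP => l; rewrite !ffunE.
rewrite -[RHS](sum_indic (fun m => tw_cst m j * (tw_op m j == l)%:R)).
apply: eq_bigr => m _.
rewrite -(sum_indic (fun n => tw_cst m n * (tw_op m n == l)%:R)) mulr_sumr.
by apply: eq_bigr => n _; rewrite !ffunE !mulrA.
Qed.

Lemma twalg_oneE : 1 = \sum_(i in tw_unit T) tw_basis i :> A.
Proof.
apply/ffunP => l; rewrite sum_ffunE big_mkcond ffunE /=.
rewrite -(sum_indic (fun j => (j \in tw_unit T)%:R)); apply: eq_bigr => i _.
by rewrite ffunE eq_sym; case: (i \in _); rewrite ?mulr1 ?mulr0.
Qed.

End TwistedAlgebra.

(* Finite-dimensional left modules over an algebra. *)
Record module (k : fieldType) (A : algType k) := Module {
  carrier :> vectType k;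
  act : {linear A -> 'End(carrier)};
  act1 : act 1 = \1%VF;
  actM : forall a b : A, act (a * b) = (act a \o act b)%VF }.

Section Modules.
Variables (k : fieldType) (A : algType k).

Definition submodule (M : module A) (U : {vspace M}) : Prop :=
  forall a : A, (act M a @: U <= U)%VS.

Definition simple_module (M : module A) : Prop :=
  (fullv : {vspace M}) <> 0%VS /\
  forall U : {vspace M}, submodule U -> U = 0%VS \/ U = fullv.

Definition module_hom (M N : module A) (f : 'Hom(M, N)) : Prop :=
  forall a : A, (f \o act M a)%VF = (act N a \o f)%VF.

(* M is a direct sum of the N i: a biproduct in the category of modules. *)
Definition is_direct_sum (n : nat) (N : 'I_n -> module A) (M : module A) : Prop :=
  exists (inj : forall i, 'Hom(N i, M)) (prj : forall i, 'Hom(M, N i)),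
    [/\ forall i, module_hom (inj i), forall i, module_hom (prj i),
        forall i, (prj i \o inj i)%VF = \1%VF,
        forall i j, i != j -> (prj i \o inj j)%VF = 0
      & \sum_i (inj i \o prj i)%VF = \1%VF].

End Modules.

Definition lftrace (k : fieldType) (V : vectType k) (f : 'End(V)) : k :=
  let b := vbasis (fullv : {vspace V}) in \sum_i coord b i (f b`_i).

(* Trace of the restriction of f to a subspace U; meaningful when f U <= U. *)
Definition lftrace_on (k : fieldType) (V : vectType k) (U : {vspace V})
    (f : 'End(V)) : k :=
  lftrace (linfun (vsproj U) \o f \o linfun (@vsval _ _ U))%VF.

(* Normalized 3-cocycles G^3 -> k^*, where G is the whole of gT. *)
Record cocycle3 (k : fieldType) (gT : finGroupType) := Cocycle3 {
  cocycle3_fun :> gT -> gT -> gT -> k;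
  cocycle3_neq0 : forall x y z, cocycle3_fun x y z != 0;
  cocycle3P : forall g1 g2 g3 g4 : gT,
    cocycle3_fun g2 g3 g4 * cocycle3_fun g1 (g2 * g3)%g g4 * cocycle3_fun g1 g2 g3
    = cocycle3_fun (g1 * g2)%g g3 g4 * cocycle3_fun g1 g2 (g3 * g4)%g;
  cocycle3_norm : forall g l : gT, cocycle3_fun g 1%g l = 1 }.

Section DPR.
Variables (k : fieldType) (gT : finGroupType) (w : cocycle3 k gT).

Definition beta (a x y : gT) : k :=
  w a x y * w x y (y^-1 * x^-1 * a * x * y)%g / w x (x^-1 * a * x)%g y.

Lemma cocycle3_1l y z : w 1%g y z = 1.
Proof.
apply: (mulfI (cocycle3_neq0 w 1%g y z)); rewrite mulr1.
by have := cocycle3P w 1 1 y z; rewrite !mul1g !cocycle3_norm !mulr1; apply.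
Qed.

Lemma cocycle3_1r x y : w x y 1%g = 1.
Proof.
apply: (mulfI (cocycle3_neq0 w x y 1%g)); rewrite mulr1.
by have := cocycle3P w x y 1 1; rewrite !mulg1 !cocycle3_norm !mul1r; apply.
Qed.

Lemma beta1l a y : beta a 1 y = 1.
Proof. by rewrite /beta cocycle3_norm !cocycle3_1l invr1 !mulr1. Qed.

Lemma beta1r a x : beta a x 1 = 1.
Proof. by rewrite /beta cocycle3_norm !cocycle3_1r invr1 !mulr1. Qed.

Lemma beta_cocycle a x y z :
  beta a x y * beta a (x * y)%g z = beta (x^-1 * a * x)%g y z * beta a x (y * z)%g.
Proof.
rewrite /beta !invMg !mulgA.
set b := (x^-1 * a * x)%g; set c := (y^-1 * x^-1 * a * x * y)%g.
set d := (z^-1 * y^-1 * x^-1 * a * x * y * z)%g.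
have nz := cocycle3_neq0 w.
have E1 := cocycle3P w a x y z.
have E2 := cocycle3P w x b y z.
have E3 := cocycle3P w x y c z.
have E4 := cocycle3P w x y z d.
have xb : (x * b = a * x)%g by rewrite /b !mulgA mulgV mul1g.
have yc : (y * c = b * y)%g by rewrite /c /b !mulgA mulgV mul1g.
have zd : (z * d = c * z)%g by rewrite /d /c !mulgA mulgV mul1g.
rewrite xb in E2; rewrite yc in E3; rewrite zd in E4.
have F1 : w a (x * y)%g z = w (a * x)%g y z * w a x (y * z)%g / (w x y z * w a x y).
  by rewrite -E1; field; rewrite !nz.
have F2 : w b y z = w (a * x)%g y z * w x b (y * z)%g / (w x (b * y)%g z * w x b y).
  by rewrite -E2; field; rewrite !nz.
have F3 : w x y c = w (x * y)%g c z * w x y (c * z)%g / (w y c z * w x (b * y)%g z).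
  by rewrite -E3; field; rewrite !nz.
have F4 : w (x * y)%g z d = w y z d * w x (y * z)%g d * w x y z / w x y (c * z)%g.
  by rewrite E4; field; rewrite !nz.
by rewrite F1 F2 F3 F4; field; rewrite !nz.
Qed.

(* The basis element (delta_g xbar) of D^w(G) is indexed by the pair (g, x). *)
Definition DPR_op (p q : gT * gT) : gT * gT := (p.1, (p.2 * q.2)%g).
Definition DPR_cst (p q : gT * gT) : k :=
  if q.1 == (p.2^-1 * p.1 * p.2)%g then beta p.1 p.2 q.2 else 0.
Definition DPR_unit : {set gT * gT} := [set p | p.2 == 1%g].

Lemma DPR_opA : associative DPR_op.
Proof. by move=> p q r; rewrite /DPR_op /= mulgA. Qed.

Lemma DPR_cstA p q r :
  DPR_cst p q * DPR_cst (DPR_op p q) r = DPR_cst q r * DPR_cst p (DPR_op q r).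
Proof.
case: p q r => [g x] [h y] [l z]; rewrite /DPR_cst /DPR_op /=.
have [->|_] := eqVneq h (x^-1 * g * x)%g; last by rewrite mulr0 mul0r.
rewrite invMg !mulgA; case: eqP => _; last by rewrite mulr0 mul0r.
by rewrite beta_cocycle.
Qed.

Lemma DPR_1l q r :
  \sum_(p in DPR_unit) DPR_cst p q * (DPR_op p q == r)%:R = (q == r)%:R.
Proof.
case: q => h y; rewrite (bigD1 (h, 1%g)) ?inE //= big1 => [|[g x]].
  by rewrite addr0 /DPR_cst /DPR_op /= invg1 mulg1 !mul1g eqxx beta1l mul1r.
rewrite inE /= => /andP[/eqP-> neq]; rewrite /DPR_cst /= invg1 mulg1 mul1g.
case: eqP => [eq_hg|_]; last by rewrite mul0r.
by rewrite eq_hg eqxx in neq.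
Qed.

Lemma DPR_1r q r :
  \sum_(p in DPR_unit) DPR_cst q p * (DPR_op q p == r)%:R = (q == r)%:R.
Proof.
case: q => h y; rewrite (bigD1 ((y^-1 * h * y)%g, 1%g)) ?inE //= big1 => [|[g x]].
  by rewrite addr0 /DPR_cst /DPR_op /= mulg1 eqxx beta1r mul1r.
rewrite inE /= => /andP[/eqP-> neq]; rewrite /DPR_cst /=.
case: eqP => [eq_hg|_]; last by rewrite mul0r.
by rewrite eq_hg eqxx in neq.
Qed.

Lemma DPR_unit_neq0 : DPR_unit != set0.
Proof. by apply/set0Pn; exists (1%g, 1%g); rewrite inE. Qed.

Definition DPR : algType k :=
  twalg (Twist DPR_opA DPR_cstA DPR_1l DPR_1r DPR_unit_neq0).

Definition delta (g x : gT) : DPR :=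
  @tw_basis k (Twist DPR_opA DPR_cstA DPR_1l DPR_1r DPR_unit_neq0) (g, x).

Lemma deltaM g x h y :
  delta g x * delta h y
  = if h == (x^-1 * g * x)%g then beta g x y *: delta g (x * y)%g else 0.
Proof.
by rewrite /delta tw_basisM /= /DPR_cst /=; case: eqP; rewrite ?scale0r.
Qed.

Lemma DPR_oneE : 1 = \sum_g delta g 1%g.
Proof.
rewrite [LHS]twalg_oneE /=.
transitivity (\sum_(p : gT * gT | true && (p.2 == 1%g)) delta p.1 p.2).
  by apply: eq_big => [p|[g x] _]; rewrite ?inE.
rewrite -(pair_big_dep xpredT (fun _ x => x == 1%g) delta) /=.
by apply: eq_bigr => g _; rewrite big_pred1_eq.
Qed.

Section TwistedGroupAlgebra.
Variable a : gT.
Local Notation C := [subg 'C[a]].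

Definition tga_cst (x y : C) : k := beta a (sgval x) (sgval y).

Lemma tga_cstA x y z :
  tga_cst x y * tga_cst (x * y)%g z = tga_cst y z * tga_cst x (y * z)%g.
Proof.
rewrite /tga_cst beta_cocycle; congr (beta _ _ _ * _).
by have /cent1P := subgP x; rewrite -mulgA => <-; rewrite mulKg.
Qed.

Lemma tga_1l y z : \sum_(x in [set 1%g]) tga_cst x y * (x * y == z)%g%:R = (y == z)%:R.
Proof. by rewrite big_set1 /tga_cst beta1l mul1r mul1g. Qed.

Lemma tga_1r y z : \sum_(x in [set 1%g]) tga_cst y x * (y * x == z)%g%:R = (y == z)%:R.
Proof. by rewrite big_set1 /tga_cst beta1r mul1r mulg1. Qed.

Lemma tga_unit_neq0 : [set 1%g] != set0 :> {set C}.
Proof. by apply/set0Pn; exists 1%g; rewrite inE. Qed.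

(* The twisted group algebra k^(beta_a)[C_G(a)]. *)
Definition tga : algType k :=
  twalg (Twist (@mulgA C) tga_cstA tga_1l tga_1r tga_unit_neq0).

Definition tga_bar (x : C) : tga :=
  @tw_basis k (Twist (@mulgA C) tga_cstA tga_1l tga_1r tga_unit_neq0) x.

Lemma tga_barM x y :
  tga_bar x * tga_bar y = beta a (sgval x) (sgval y) *: tga_bar (x * y)%g.
Proof. exact: tw_basisM. Qed.

Lemma tga_oneE : 1 = tga_bar 1%g.
Proof. by rewrite [LHS]twalg_oneE big_set1. Qed.

(* Characters are functions on gT; only their values on C_G(a) matter. *)
Definition affords (N : module tga) (chi : gT -> k) : Prop :=
  forall x : C, chi (sgval x) = lftrace (act N (tga_bar x)).

Definition irr_beta_char (chi : gT -> k) : Prop :=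
  exists N : module tga, simple_module N /\ affords N chi.

(* M is the simple object labelled (a, chi).  U is the subspace (delta_a ebar) M;
   for x in C_G(a), delta_a xbar maps M into U. *)
Definition is_simple_object (chi : gT -> k) (M : module DPR) : Prop :=
  let U := limg (act M (delta a 1%g)) in
  [/\ simple_module M, U <> 0%VS
    & forall x, x \in 'C[a]%g -> chi x = lftrace_on U (act M (delta a x))].

End TwistedGroupAlgebra.

Definition omega_bichar (K H : {set gT}) (B : gT -> gT -> k) : Prop :=
  [/\ {in K & H, forall x y, B x y != 0},
      forall x y z, x \in K -> y \in H -> z \in H ->
        B x (y * z)%g = (beta x y z)^-1 * B x y * B x z
    & forall v x y, v \in K -> x \in K -> y \in H ->
        B (v * x)%g y = beta y v x * B v y * B x y].

Definition G_invariant (K H : {set gT}) (B : gT -> gT -> k) : Prop :=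
  forall x h g, x \in K -> h \in H ->
    B (g^-1 * x * g)%g h
    = beta x g h * beta x (g * h)%g g^-1%g / beta x g g^-1%g * B x (g * h * g^-1)%g.

(* The objects of the full subcategory S(K, H, B) of Rep(D^w(G)); R is a set of
   representatives of the conjugacy classes of G. *)
Definition in_S (R K H : {set gT}) (B : gT -> gT -> k) (M : module DPR) : Prop :=
  exists (n : nat) (N : 'I_n -> module DPR),
    is_direct_sum N M /\
    forall i, exists (a : gT) (chi : gT -> k),
      [/\ a \in K :&: R, irr_beta_char a chi, is_simple_object a chi (N i)
        & {in H, forall h, chi h = B a h * chi 1%g}].

End DPR.

(* Main.v *)
(* The trace of delta_a x on a simple module M with delta_a M <> 0 is the value
   at x of the character of the label of M, and a is determined by M up to
   conjugacy.  Since a simple direct sum is isomorphic to one of its summands,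
   an inclusion S(K, H, B) <= S(K', H', B') carries the condition
   tr(delta_a h) = B(a, h) tr(delta_a e) for h in H, a in K, to the same
   condition for B', H', with a in K'.
   For each a in K, the element e = sum_h B(a, h)^-1 delta_a h of D^w(G)
   generates a left ideal on which h in H acts through B(a, h) on the image of
   delta_a; its simple submodules give K <= K' and B = B' on K x (H' :&: H).
   For a = 1 the objects of S(K, H, B) include all irreducible representations
   of G / H.  On each of them, h in H' has the same trace as the identity, hence
   so it has on the regular representation of G / H, so that h is in H. *)
From HB Require Import structures.
From mathcomp Require Import all_boot all_order all_algebra all_fingroup.
From mathcomp Require Import pgroup mxrepresentation ring.
From Stdlib Require Import Classical.
Require Import Defs.

Set Implicit Arguments.
Unset Strict Implicit.
Unset Printing Implicit Defensive.

Import GRing.Theory.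
Local Open Scope ring_scope.

(** * Traces of endomorphisms, computed from frames *)

Section Trace.
Variable k : fieldType.
Implicit Types U V W : vectType k.

(* A spanning family with linear coordinate functions; it need not be free,
   and the trace can still be computed from it. *)
Definition frame V n (e : 'I_n -> V) (p : 'I_n -> {linear V -> k^o}) : Prop :=
  forall v, v = \sum_i p i v *: e i.

(** Expanding [f (e i)] along [d] and [g (d j)] along [e] turns both sides into the same double sum.
    With [g] the identity this shows that the trace does not depend on the frame; in general it is
    the cyclicity of the trace. *)
Lemma frame_traceC V W m n (e : 'I_m -> V) p (d : 'I_n -> W) q
    (f : 'Hom(V, W)) (g : 'Hom(W, V)) : frame e p -> frame d q ->
  \sum_i p i (g (f (e i))) = \sum_j q j (f (g (d j))).
Proof.
move=> ep dq.
under eq_bigr => i _ do rewrite (dq (f (e i))) !linear_sum.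
under [RHS]eq_bigr => j _ do rewrite (ep (g (d j))) !linear_sum.
rewrite exchange_big /=; apply: eq_bigr => j _; apply: eq_bigr => i _.
by rewrite !linearZ /= /GRing.scale /= mulrC.
Qed.

Lemma frame_basis V :
  frame (fun i : 'I_(\dim {:V}) => (vbasis {:V})`_i)
        (fun i => coord (vbasis {:V}) i : {linear V -> k^o}).
Proof. by move=> v; apply: coord_vbasis; rewrite memvf. Qed.

Lemma frame_lftrace V n (e : 'I_n -> V) p (f : 'End(V)) :
  frame e p -> lftrace f = \sum_i p i (f (e i)).
Proof.
move=> ep; rewrite /lftrace.
have := frame_traceC f \1%VF (@frame_basis V) ep.
under eq_bigr do rewrite id_lfunE; move=> ->.
by apply: eq_bigr => i _; rewrite id_lfunE.
Qed.

Lemma lftrace_comp V W (f : 'Hom(V, W)) (g : 'Hom(W, V)) :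
  lftrace (g \o f)%VF = lftrace (f \o g)%VF.
Proof.
rewrite /lftrace; under eq_bigr do rewrite comp_lfunE.
under [RHS]eq_bigr do rewrite comp_lfunE.
exact: (frame_traceC f g (@frame_basis V) (@frame_basis W)).
Qed.

Lemma lftraceZ V (c : k) (f : 'End(V)) : lftrace (c *: f) = c * lftrace f.
Proof.
by rewrite /lftrace mulr_sumr; apply: eq_bigr => i _; rewrite scale_lfunE linearZ.
Qed.

Lemma lftrace1 V : lftrace (\1%VF : 'End(V)) = (\dim {:V})%:R.
Proof.
rewrite /lftrace; under eq_bigr => i _ do
  rewrite id_lfunE coord_free ?eqxx ?(basis_free (vbasisP _)) //.
by rewrite sumr_const card_ord.
Qed.

(** By cyclicity the inclusion of [U] moves to the left of the projection; their composite fixes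
    [U], hence the image of [f]. *)
Lemma lftrace_onE V (U : {vspace V}) (f : 'End(V)) :
  (limg f <= U)%VS -> lftrace_on U f = lftrace f.
Proof.
move=> sfU; rewrite /lftrace_on lftrace_comp; congr lftrace.
apply/lfunP => v; rewrite !comp_lfunE !lfunE /= vsprojK //.
exact/(subvP sfU)/memv_img/memvf.
Qed.

Lemma lftrace_on_id V (U : {vspace V}) (f : 'End(V)) :
  {in U, forall u, f u = u} -> lftrace_on U f = (\dim U)%:R.
Proof.
move=> fid; rewrite /lftrace_on (_ : (_ \o _)%VF = \1%VF).
  by rewrite lftrace1 dimvf.
apply/lfunP => u; rewrite !comp_lfunE !lfunE /= fid ?subvsP //.
by rewrite vsvalK.
Qed.

Lemma lftrace_rV n (f : {linear 'rV[k]_n -> 'rV[k]_n}) :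
  lftrace (linfun f) = \tr (lin1_mx f).
Proof.
pose p (i : 'I_n) (v : 'rV[k]_n) : k^o := v 0 i.
have p_lin i : linear (p i) by move=> c u v; rewrite /p !mxE.
pose P i : {linear 'rV[k]_n -> k^o} :=
  HB.pack (p i) (GRing.isLinear.Build _ _ _ _ (p i) (p_lin i)).
rewrite (@frame_lftrace _ n (fun i => delta_mx 0 i) P) => [|v].
  by apply: eq_bigr => i _; rewrite lfunE /= /p mxE.
exact: row_sum_delta.
Qed.

End Trace.

(** * Submodules, simple modules and isomorphisms *)

Section Modules.
Variables (k : fieldType) (A : algType k).
Implicit Types M N : module A.

Lemma actMv M (a b : A) (v : M) : act M (a * b) v = act M a (act M b v).
Proof. by rewrite actM comp_lfunE. Qed.

Lemma act1v M (v : M) : act M 1 v = v.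
Proof. by rewrite act1 id_lfunE. Qed.

Lemma memv_submodule M (U : {vspace M}) (a : A) u :
  submodule U -> u \in U -> act M a u \in U.
Proof. by move=> sU Uu; apply/(subvP (sU a))/memv_img. Qed.

Section SubModule.
Variables (M : module A) (U : {vspace M}).

Definition sub_act (a : A) : 'End(subvs_of U) :=
  (linfun (vsproj U) \o act M a \o linfun (@vsval _ _ U))%VF.

Lemma sub_act_linear : linear sub_act.
Proof.
move=> c a b; apply/lfunP => u; rewrite /sub_act linearP /=.
by rewrite !(comp_lfunE, add_lfunE, scale_lfunE, lfunE) /= linearP.
Qed.
HB.instance Definition _ :=
  GRing.isLinear.Build k A 'End(subvs_of U) _ sub_act sub_act_linear.

Hypothesis sU : submodule U.

Lemma vsval_sub_act a u : vsval (sub_act a u) = act M a (vsval u).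
Proof.
by rewrite !comp_lfunE !lfunE /= vsprojK ?(memv_submodule _ sU) ?subvsP.
Qed.

Lemma sub_act1 : sub_act 1 = \1%VF.
Proof.
by apply/lfunP => u; apply: subvs_inj; rewrite vsval_sub_act act1v id_lfunE.
Qed.

Lemma sub_actM a b : sub_act (a * b) = (sub_act a \o sub_act b)%VF.
Proof.
apply/lfunP => u; apply: subvs_inj.
by rewrite comp_lfunE !vsval_sub_act actMv.
Qed.

Definition sub_module : module A := Module sub_act1 sub_actM.

End SubModule.

(** Induction on the dimension: either [W] has a smaller nonzero submodule, or [W] itself is
    simple. *)
Lemma exists_simple_submodule M (W : {vspace M}) :
  submodule W -> W <> 0%VS ->
  exists (U : {vspace M}) (sU : submodule U), (U <= W)%VS /\ simple_module (sub_module sU).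
Proof.
have [n] := ubnP (\dim W); elim: n W => // n IHn W /ltnSE leWn sW nzW.
have [[U [sU nzU ltUW]]|noU] := classic (exists U : {vspace M},
    [/\ submodule U, U <> 0%VS & (U <= W)%VS && (U != W)]).
  case/andP: ltUW => sUW neUW.
  have ltd : (\dim U < \dim W)%N.
    by rewrite ltn_neqAle dimvS // andbT; apply: contra neUW => /eqP eqd; rewrite eqEdim sUW eqd leqnn.
  have [V [sV [sVU simV]]] := IHn U (leq_trans ltd leWn) sU nzU.
  by exists V, sV; split=> //; apply: subv_trans sUW.
exists W, sW; split=> //; split.
  move=> F0; apply: nzW; apply/eqP; rewrite -dimv_eq0.
  by have := dimvf (sub_module sW); rewrite F0 dimv0 => e; apply/eqP; exact: esym e.
move=> U sU; have [->|nzU] := eqVneq U 0%VS; [by left | right].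
(* [X] is [U] seen inside [M]. It is a nonzero submodule below [W], so [noU] forces it to be [W]. *)
pose X := (linfun (@vsval _ _ W) @: U)%VS.
have dX : \dim X = \dim U.
  apply: limg_dim_eq; apply/eqP; rewrite -subv0; apply/subvP => u.
  rewrite memv_cap memv_ker lfunE /= memv0 => /andP[_ /eqP u0].
  apply/eqP/subvs_inj; rewrite linear0; exact: u0.
have sX : submodule X.
  move=> a; apply/subvP => _ /memv_imgP[_ /memv_imgP[u Uu ->] ->].
  rewrite lfunE /= -vsval_sub_act //.
  rewrite -(lfunE (@vsval _ _ W)) /=.
  exact/memv_img/(subvP (sU a))/memv_img.
have XW : (X <= W)%VS.
  by apply/subvP => _ /memv_imgP[u _ ->]; rewrite lfunE subvsP.
apply/eqP; rewrite eqEdim subvf dimvf -[X in (X <= _)%N]/(\dim W) -dX.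
have [eqXW|neXW] := eqVneq X W; first by rewrite eqXW; exact: leqnn.
case: noU; exists X; split=> //; last by rewrite XW neXW.
by move=> X0; move/eqP: dX; rewrite X0 dimv0 eq_sym dimv_eq0 (negPf nzU).
Qed.

(* A nonzero idempotent endomorphism of a simple module is the identity. *)
Lemma simple_summand M n (N : 'I_n -> module A) :
  simple_module M -> is_direct_sum N M ->
  exists i (f : 'Hom(M, N i)) (g : 'Hom(N i, M)),
    [/\ module_hom f, (f \o g = \1)%VF & (g \o f = \1)%VF].
Proof.
move=> [nzM simM] [inj [prj [homi homp pi1 _ sum1]]].
have [i nzi] : exists i, (inj i \o prj i)%VF != 0.
  apply/existsP; rewrite -[[exists i, _]]negbK negb_exists; apply/forallP => all0.
  apply: nzM; apply/eqP; rewrite -subv0; apply/subvP => v _.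
  have := congr1 (fun f : 'End(M) => f v) sum1; rewrite id_lfunE => <-.
  rewrite big1 ?zero_lfunE ?mem0v // => i _.
  by apply/eqP; rewrite -[_ == _]negbK all0.
exists i, (prj i), (inj i); split=> //.
set e := (inj i \o prj i)%VF in nzi *.
have sE : submodule (limg e).
  move=> a; rewrite -limg_comp (_ : (_ \o _)%VF = (e \o act M a)%VF).
    by rewrite limg_comp limgS ?subvf.
  by rewrite /e comp_lfunA -homi -!comp_lfunA homp.
have [E0|Ef] := simM _ sE.
  case/negP: nzi; apply/eqP/lfunP => v; rewrite zero_lfunE; apply/eqP.
  by rewrite -memv0 -E0 memv_img ?memvf.
apply/lfunP => v; rewrite id_lfunE.
have /memv_imgP[u _ ->] : v \in limg e by rewrite Ef memvf.
rewrite -comp_lfunE /e -comp_lfunA [(prj i \o _)%VF]comp_lfunA pi1.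
by rewrite comp_lfun1l.
Qed.

Lemma iso_act M N (f : 'Hom(M, N)) (g : 'Hom(N, M)) (a : A) :
  module_hom f -> (f \o g = \1)%VF -> act N a = (f \o (act M a \o g))%VF.
Proof. by move=> homf fg; rewrite comp_lfunA homf -comp_lfunA fg comp_lfun1r. Qed.

Lemma iso_lftrace M N (f : 'Hom(M, N)) (g : 'Hom(N, M)) (a : A) :
  module_hom f -> (f \o g = \1)%VF -> (g \o f = \1)%VF ->
  lftrace (act N a) = lftrace (act M a).
Proof.
move=> homf fg gf.
by rewrite (iso_act a homf fg) lftrace_comp -comp_lfunA gf comp_lfun1r.
Qed.

Lemma simple_direct_sum1 M : is_direct_sum (fun _ : 'I_1 => M) M.
Proof.
exists (fun _ => \1%VF), (fun _ => \1%VF); split.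
- by move=> i a; rewrite comp_lfun1l comp_lfun1r.
- by move=> i a; rewrite comp_lfun1l comp_lfun1r.
- by move=> i; rewrite comp_lfun1l.
- by move=> i j; rewrite !ord1.
- by rewrite big_ord_recl big_ord0 addr0 comp_lfun1l.
Qed.

End Modules.

(** * Linear and bilinear identities checked on a spanning family *)

Section BilinearExtension.
Variables (k : fieldType) (A V : lmodType k) (I : finType) (b : I -> A).
Hypothesis span_b : forall u, exists c : I -> k, u = \sum_i c i *: b i.

Lemma linear_span_eq (f g : A -> V) : linear f -> linear g ->
  (forall i, f (b i) = g (b i)) -> f =1 g.
Proof.
move=> linf ling fg u; have [c ->] := span_b u.
pose F : {linear A -> V} := HB.pack f (GRing.isLinear.Build _ _ _ _ f linf).
pose G : {linear A -> V} := HB.pack g (GRing.isLinear.Build _ _ _ _ g ling).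
rewrite -[f _]/(F _) -[g _]/(G _) !linear_sum; apply: eq_bigr => i _.
by rewrite !linearZ /= fg.
Qed.

Lemma bilinear_span_eq (f g : A -> A -> V) :
  (forall u, linear (f u)) -> (forall v, linear (f^~ v)) ->
  (forall u, linear (g u)) -> (forall v, linear (g^~ v)) ->
  (forall i j, f (b i) (b j) = g (b i) (b j)) -> f =2 g.
Proof.
move=> fr fl gr gl fg u v; apply: (linear_span_eq (fl v) (gl v)) => i.
exact: (linear_span_eq (fr _) (gr _)).
Qed.

End BilinearExtension.

(** * The left regular module *)

Section RegularModule.
Variables (k : fieldType) (T : twist k).
Local Notation A := (twalg T).

HB.instance Definition _ := Vector.copy A {ffun tw_idx T -> k^o}.

Lemma twalg_sum_basis (u : A) : u = \sum_i (u i : k) *: tw_basis i.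
Proof.
apply/ffunP => l; rewrite sum_ffunE -[LHS](sum_indic (fun i => u i : k)).
by apply: eq_bigr => i _; rewrite !ffunE eq_sym /GRing.scale /= mulrC.
Qed.

Lemma regular_act_linear (u : A) : linear ( *%R u : A -> A).
Proof. by move=> c v x; rewrite mulrDr scalerAr. Qed.
HB.instance Definition _ u :=
  GRing.isLinear.Build k A A _ ( *%R u : A -> A) (regular_act_linear u).

Definition regular_act (u : A) : 'End(A) := linfun ( *%R u : A -> A).

Lemma regular_act_is_linear : linear regular_act.
Proof.
move=> c u v; apply/lfunP => x.
by rewrite add_lfunE scale_lfunE !lfunE /= mulrDl scalerAl.
Qed.
HB.instance Definition _ :=
  GRing.isLinear.Build k A 'End(A) _ regular_act regular_act_is_linear.

Lemma regular_act1 : regular_act 1 = \1%VF.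
Proof. by apply/lfunP => x; rewrite id_lfunE lfunE /= mul1r. Qed.

Lemma regular_actM u v : regular_act (u * v) = (regular_act u \o regular_act v)%VF.
Proof. by apply/lfunP => x; rewrite comp_lfunE !lfunE /= mulrA. Qed.

Definition regular_module : module A := Module regular_act1 regular_actM.

End RegularModule.

(** * Modules over the quasi-Hopf algebra and their supports *)

Section DPRModules.
Variables (k : fieldType) (gT : finGroupType) (w : cocycle3 k gT).
Local Notation D := (DPR w).
Local Notation delta := (@delta k gT w).
Implicit Type M : module D.

Lemma beta_neq0 a x y : beta w a x y != 0.
Proof. by rewrite /beta !mulf_neq0 ?invr_eq0 ?cocycle3_neq0. Qed.

Lemma DPR_sum_delta (u : D) : u = \sum_(p : gT * gT) ((u : twalg _) p : k) *: delta p.1 p.2.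
Proof.
by rewrite [LHS]twalg_sum_basis; apply: eq_bigr => [[g x]] _.
Qed.

Lemma submodule_delta M (U : {vspace M}) :
  (forall g x, {in U, forall u, act M (delta g x) u \in U}) -> submodule U.
Proof.
move=> sU a; apply/subvP => _ /memv_imgP[u Uu ->].
rewrite (DPR_sum_delta a) linear_sum sum_lfunE rpred_sum // => p _.
by rewrite linearZ scale_lfunE rpredZ // sU.
Qed.

(** The submodule generated by [V], as the [delta g x] span the algebra. *)
Definition span_delta M (V : {vspace M}) : {vspace M} :=
  (\sum_(p : gT * gT) (act M (delta p.1 p.2) @: V))%VS.

Lemma span_delta_submodule M (V : {vspace M}) : submodule (span_delta V).
Proof.
apply: submodule_delta => g x u /memv_sumP[v Vv ->].
rewrite linear_sum rpred_sum // => [[h y]] _.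
have /memv_imgP[{}u Vu ->] := Vv (h, y) isT; rewrite /= -actMv deltaM.
case: eqP => _; last by rewrite linear0 zero_lfunE mem0v.
rewrite linearZ scale_lfunE rpredZ //.
by apply/(subvP (sumv_sup (g, (x * y)%g) _ (subvv _)))/memv_img.
Qed.

Lemma sub_span_delta M (V : {vspace M}) : (V <= span_delta V)%VS.
Proof.
apply/subvP => v Vv; rewrite -(act1v v) DPR_oneE linear_sum sum_lfunE.
rewrite rpred_sum // => g _.
by apply/(subvP (sumv_sup (g, 1%g) _ (subvv _)))/memv_img.
Qed.

Lemma span_delta_full M (V : {vspace M}) :
  simple_module M -> V <> 0%VS -> span_delta V = fullv.
Proof.
move=> [_ simM] nzV; case: (simM _ (span_delta_submodule V)) => // V0.
by case: nzV; apply/eqP; rewrite -subv0 -V0 sub_span_delta.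
Qed.

Lemma delta_id a x : delta a 1%g * delta a x = delta a x.
Proof. by rewrite deltaM invg1 mulg1 mul1g eqxx beta1l scale1r mul1g. Qed.

Lemma act_delta_neq0 M a :
  limg (act M (delta a 1%g)) <> 0%VS <-> act M (delta a 1%g) <> 0.
Proof.
split=> h e; apply: h; last first.
  apply/lfunP => v; rewrite zero_lfunE; apply/eqP.
  by rewrite -memv0 -e memv_img ?memvf.
by rewrite e lim0g.
Qed.

Lemma limg_act_delta M a x :
  (limg (act M (delta a x)) <= limg (act M (delta a 1%g)))%VS.
Proof. by rewrite -delta_id actM limg_comp limgS ?subvf. Qed.

Lemma act_delta_id M a :
  {in limg (act M (delta a 1%g)), forall u, act M (delta a 1%g) u = u}.
Proof. by move=> _ /memv_imgP[u _ ->]; rewrite -actMv delta_id. Qed.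

(** The image of [delta b 1] generates [M], and [delta a 1 * delta g x * delta b 1] vanishes unless
    [g = a] and [b] is the conjugate of [a] by [x]. Without such an [x], [delta a 1] would kill all
    of [M]. *)
Lemma simple_conj M a b : simple_module M ->
  act M (delta a 1%g) <> 0 -> act M (delta b 1%g) <> 0 ->
  exists x, b = (x^-1 * a * x)%g.
Proof.
move=> simM nza /act_delta_neq0 nzb.
apply: NNPP => nconj; apply: nza; apply/lfunP => v; rewrite zero_lfunE.
have: v \in span_delta (limg (act M (delta b 1%g))) by rewrite span_delta_full ?memvf.
case/memv_sumP => vs Vv ->; rewrite linear_sum big1 // => [[g x]] _.
have /memv_imgP[u /memv_imgP[t _ ->] ->] := Vv (g, x) isT.
rewrite /= -!actMv deltaM.
have [gb|_] := eqVneq; last by rewrite mul0r linear0 zero_lfunE.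
rewrite -scalerAl deltaM /=; have [bx|_] := eqVneq; last first.
  by rewrite scaler0 linear0 zero_lfunE.
case: nconj; exists x.
by rewrite bx mul1g.
Qed.

(** [delta g x * delta a x^-1] is a nonzero multiple of [delta g 1], and it factors through
    [delta a 1]. *)
Lemma act_delta_conj0 M a x g :
  act M (delta a 1%g) = 0 -> (x^-1 * g * x)%g = a -> act M (delta g 1%g) = 0.
Proof.
move=> a0 gxa.
have: act M (delta g x * (delta a 1%g * delta a x^-1%g)) = 0.
  by rewrite !actM a0 comp_lfun0l comp_lfun0r.
rewrite delta_id deltaM gxa eqxx mulgV linearZ => /eqP.
by rewrite scaler_eq0 (negPf (beta_neq0 _ _ _)) => /eqP.
Qed.

(** * The twisted group algebra as the corner at [a], and labels of simple modules *)

Section Corner.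
Variable a : gT.

(** A non-unital embedding: the unit goes to the idempotent [delta a 1], which acts as the identity
    on its own image. *)
Definition tga_inc (u : tga w a) : D :=
  \sum_c ((u : twalg _) c : k) *: delta a (sgval c).

Lemma tga_inc_linear : linear tga_inc.
Proof.
move=> c u v; rewrite /tga_inc scaler_sumr -big_split; apply: eq_bigr => i _.
by rewrite !ffunE scalerDl scalerA.
Qed.
HB.instance Definition _ :=
  GRing.isLinear.Build k (tga w a) D _ tga_inc tga_inc_linear.

Lemma tga_inc_bar c : tga_inc (tga_bar w c) = delta a (sgval c).
Proof.
rewrite /tga_inc (bigD1 c) //= big1 => [|d ned].
  by rewrite ffunE eqxx scale1r addr0.
by rewrite ffunE eq_sym (negPf ned) scale0r.
Qed.

Lemma tga_incM u v : tga_inc (u * v) = tga_inc u * tga_inc v.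
Proof.
move: u v; apply: (@bilinear_span_eq _ _ _ _ (tga_bar w (a := a))).
- by move=> u; exists (u : twalg _); apply: twalg_sum_basis.
- by move=> u c v v'; rewrite mulrDr -scalerAr tga_inc_linear.
- by move=> v c u u'; rewrite mulrDl -scalerAl tga_inc_linear.
- by move=> u c v v'; rewrite tga_inc_linear mulrDr -scalerAr.
- by move=> v c u u'; rewrite tga_inc_linear mulrDl -scalerAl.
move=> c d; rewrite tga_barM linearZ /= !tga_inc_bar deltaM ifT //.
have /cent1P := subgP c; rewrite -mulgA => <-.
by rewrite mulKg.
Qed.

Lemma tga_inc1 : tga_inc 1 = delta a 1%g.
Proof. by rewrite tga_oneE tga_inc_bar. Qed.

Lemma limg_act_tga_inc M u :
  (limg (act M (tga_inc u)) <= limg (act M (delta a 1%g)))%VS.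
Proof.
by rewrite -[u]mul1r tga_incM tga_inc1 actM limg_comp limgS ?subvf.
Qed.

Section CornerModule.
Variable M : module D.
Let U := limg (act M (delta a 1%g)).

(** [U] need not be a submodule of [M], but it is stable under the image of [tga_inc], so
    compressing to [U] still gives an action. *)
Definition corner_act (u : tga w a) : 'End(subvs_of U) := sub_act U (tga_inc u).

Lemma corner_act_linear : linear corner_act.
Proof. by move=> c u v; rewrite /corner_act tga_inc_linear sub_act_linear. Qed.
HB.instance Definition _ :=
  GRing.isLinear.Build k (tga w a) 'End(subvs_of U) _ corner_act corner_act_linear.

Lemma vsval_corner_act u v : vsval (corner_act u v) = act M (tga_inc u) (vsval v).
Proof.
rewrite !comp_lfunE !lfunE /= vsprojK //.
exact/(subvP (limg_act_tga_inc M u))/memv_img/memvf.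
Qed.

Lemma corner_act1 : corner_act 1 = \1%VF.
Proof.
apply/lfunP => v; apply: subvs_inj.
by rewrite vsval_corner_act tga_inc1 id_lfunE act_delta_id ?subvsP.
Qed.

Lemma corner_actM u v : corner_act (u * v) = (corner_act u \o corner_act v)%VF.
Proof.
apply/lfunP => x; apply: subvs_inj.
by rewrite comp_lfunE !vsval_corner_act tga_incM actMv.
Qed.

Definition corner : module (tga w a) := Module corner_act1 corner_actM.

Lemma corner_affords : affords corner (fun x => lftrace (act M (delta a x))).
Proof.
move=> x; rewrite /= /corner_act tga_inc_bar.
by rewrite -(lftrace_onE (limg_act_delta M a (sgval x))).
Qed.

(** A nonzero submodule [V] of the corner generates [M]. Cutting back by [delta a 1] leaves only the
    [delta a x] with [x] centralizing [a], and these preserve [V]; hence [V] is the whole corner. *)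
Lemma corner_simple : simple_module M -> U <> 0%VS -> simple_module corner.
Proof.
move=> simM nzU; split=> [F0|V sV].
  apply: nzU; apply/eqP; rewrite -dimv_eq0.
  by have := dimvf corner; rewrite F0 dimv0 => e; apply/eqP; exact: esym e.
have [->|nzV] := eqVneq V 0%VS; [by left | right].
pose X := (linfun (@vsval _ _ U) @: V)%VS.
have nzX : X <> 0%VS.
  move=> X0; case/eqP: nzV; apply/eqP; rewrite -subv0; apply/subvP => v Vv.
  rewrite memv0; apply/eqP/subvs_inj; rewrite linear0; apply/eqP.
  by rewrite -memv0 -X0 -(lfunE (@vsval _ _ U)) memv_img.
apply/eqP; rewrite eqEsubv subvf; apply/subvP => u _.
have: vsval u \in span_delta X by rewrite span_delta_full ?memvf.
case/memv_sumP => vs Xv Eu.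
(* Applying [delta a 1] termwise changes nothing on [U] and puts every term of the sum into [U]. *)
have -> : u = \sum_(p : gT * gT) vsproj U (act M (delta a 1%g) (vs p)).
  apply: subvs_inj; rewrite -(act_delta_id (subvsP u)) Eu linear_sum.
  rewrite (raddf_sum (@vsval _ _ U)); apply: eq_bigr => p _.
  by rewrite /= vsprojK ?memv_img ?memvf.
apply: rpred_sum => [[g x]] _.
have /memv_imgP[_ /memv_imgP[v Vv ->] ->] := Xv (g, x) isT.
rewrite (lfunE (@vsval _ _ U)) /= -(act_delta_id (subvsP v)) -!actMv deltaM.
have [_|_] := eqVneq; last by rewrite mul0r linear0 zero_lfunE linear0 mem0v.
rewrite mul1g beta1l scale1r deltaM.
have [ax|_] := eqVneq; last by rewrite linear0 zero_lfunE linear0 mem0v.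
have Cx : x \in 'C[a]%g by apply/cent1P/(mulgI x^-1%g); rewrite mulKg !mulgA -ax.
rewrite !linearZ scale_lfunE linearZ rpredZ //= mulg1 -[x](subgK _ Cx).
rewrite -tga_inc_bar -vsval_corner_act vsvalK.
exact: (memv_submodule _ sV).
Qed.

End CornerModule.

End Corner.

Lemma simple_object M a : simple_module M -> act M (delta a 1%g) <> 0 ->
  irr_beta_char w a (fun x => lftrace (act M (delta a x))) /\
  is_simple_object a (fun x => lftrace (act M (delta a x))) M.
Proof.
move=> simM /act_delta_neq0 nzU; split.
  by exists (corner a M); split; [exact: corner_simple | exact: corner_affords].
by split=> // x _; rewrite lftrace_onE ?limg_act_delta.
Qed.

End DPRModules.

(** * Membership of simple modules in the subcategories, as a trace condition *)

Section Transfer.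
Variables (k : fieldType) (gT : finGroupType) (w : cocycle3 k gT).
Local Notation D := (DPR w).
Local Notation delta := (@delta k gT w).
Implicit Type M : module D.

Lemma transversal_conj (R : {set gT}) a x :
  is_transversal R (classes [set: gT]) [set: gT] ->
  a \in R -> (x^-1 * a * x)%g \in R -> (x^-1 * a * x)%g = a.
Proof.
case/and3P=> _ _ /forall_inP/(_ (a ^: [set: gT])%g); rewrite mem_classes ?inE //.
move=> /(_ isT)/cards1P[b Rb] Ra Rax.
have /set1P ab : a \in [set b] by rewrite -Rb inE Ra class_refl.
have: (x^-1 * a * x)%g \in [set b].
  by rewrite -Rb inE Rax -mulgA -/(conjg a x) memJ_class ?inE.
by move/set1P=> ->.
Qed.

Lemma transversal_repr_conj (R : {set gT}) g :
  is_transversal R (classes [set: gT]) [set: gT] -> exists x, (x^-1 * g * x)%g \in R.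
Proof.
case/and3P=> _ _ /forall_inP/(_ (g ^: [set: gT])%g); rewrite mem_classes ?inE //.
move=> /(_ isT)/cards1P[b Rb].
have: b \in R :&: (g ^: [set: gT])%g by rewrite Rb set11.
by case/setIP=> bR /imsetP[x _ Eb]; exists x; rewrite -mulgA -/(conjg g x) -Eb.
Qed.

Lemma in_S_simple (R K H : {set gT}) B M a :
  simple_module M -> act M (delta a 1%g) <> 0 -> a \in K :&: R ->
  {in H, forall h,
     lftrace (act M (delta a h)) = B a h * lftrace (act M (delta a 1%g))} ->
  in_S R K H B M.
Proof.
move=> simM nza KRa trB; exists 1, (fun=> M); split; first exact: simple_direct_sum1.
move=> _; exists a, (fun x => lftrace (act M (delta a x))).
by have [irr obj] := simple_object simM nza; split.
Qed.

(** [M] is isomorphic to a summand, labelled [(b, chi)]. Both [a] and [b] support [M], so they are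
    conjugate, and equal because both lie in [R]. The isomorphism preserves traces, and [cKH] places
    [H] in the centralizer of [a], where [chi] is given by these traces. *)
Lemma simple_in_S (R K H : {set gT}) B M a :
  is_transversal R (classes [set: gT]) [set: gT] -> K \subset 'C(H)%g ->
  simple_module M -> a \in R -> act M (delta a 1%g) <> 0 -> in_S R K H B M ->
  a \in K /\
  {in H, forall h,
     lftrace (act M (delta a h)) = B a h * lftrace (act M (delta a 1%g))}.
Proof.
move=> trR cKH simM Ra nza [n [N [sumM objN]]].
have [i [f [g [homf fg gf]]]] := simple_summand simM sumM.
have [b [chi [KRb _ [_ nzU chiE] chiB]]] := objN i.
have nzb : act M (delta b 1%g) <> 0.
  move=> b0; apply: nzU; rewrite (iso_act _ homf fg) b0 comp_lfun0l comp_lfun0r.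
  exact: lim0g.
have [x Eb] := simple_conj simM nza nzb.
have ab : b = a.
  by rewrite Eb; apply: (transversal_conj trR Ra); rewrite -Eb; case/setIP: KRb.
move: KRb nzU chiE chiB; rewrite {}ab => /setIP[Ka _] _ chiE chiB; split=> // h Hh.
have trE y : y \in 'C[a]%g -> chi y = lftrace (act M (delta a y)).
  move=> Cy; rewrite chiE // lftrace_onE ?limg_act_delta //.
  exact: iso_lftrace homf fg gf.
have Ch : h \in 'C[a]%g.
  by apply/cent1P/commute_sym; exact: (centP (subsetP cKH a Ka)).
by rewrite -(trE h Ch) chiB // trE ?group1.
Qed.

End Transfer.

(** * A simple module on which [H] acts through the bicharacter *)

Section BicharacterModule.
Variables (k : fieldType) (gT : finGroupType) (w : cocycle3 k gT).
Local Notation D := (DPR w).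
Local Notation delta := (@delta k gT w).
Variables (K H : {group gT}) (B : gT -> gT -> k) (a : gT).
Hypotheses (nH : (H <| [set: gT])%g) (cKH : K \subset 'C(H)%g).
Hypotheses (bichB : omega_bichar w K H B) (invB : G_invariant w K H B).
Hypothesis Ka : a \in K.

(** Up to the factor |H|, the idempotent attached to the one-dimensional twisted character [B a] of
    [H]. *)
Definition bichar_vector : D := \sum_(h in H) (B a h)^-1 *: delta a h.
Local Notation e := bichar_vector.

Lemma conj_centralized h : h \in H -> (h^-1 * a * h)%g = a.
Proof.
by move=> Hh; rewrite -mulgA (centP (subsetP cKH a Ka) h Hh) mulKg.
Qed.

Lemma bichar1r : B a 1%g = 1.
Proof.
have [nzB BM _] := bichB.
have := BM a 1%g 1%g Ka (group1 H) (group1 H).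
rewrite mulg1 beta1l invr1 mul1r -{1}[B a 1%g]mulr1 => /mulfI -> //.
exact: nzB.
Qed.

(** Left translation by [h] permutes the terms; the factor [beta w a h x] it creates is the one in
    the bicharacter rule for [B a (h * x)]. *)
Lemma delta_bichar_vector h : h \in H -> delta a h * e = B a h *: e.
Proof.
have [nzB BM _] := bichB => Hh.
rewrite mulr_sumr scaler_sumr [RHS](reindex_inj (mulgI h)) /=.
apply: eq_big => [x|x Hx]; first by rewrite groupMl.
rewrite -scalerAr deltaM conj_centralized // eqxx !scalerA; congr (_ *: _).
rewrite BM //; move: (nzB a h Ka Hh) (nzB a x Ka Hx) (beta_neq0 w a h x).
by move: (beta w a h x) => b h0 x0 b0; field; rewrite b0 x0 h0.
Qed.

Lemma bichar_vectorE : delta a 1%g * e = e.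
Proof. by rewrite delta_bichar_vector ?group1 // bichar1r scale1r. Qed.

Lemma bichar_vector_neq0 : e != 0.
Proof.
have [nzB _ _] := bichB.
apply/eqP => /(congr1 (fun u : D => (u : twalg _) (a, 1%g) : k)).
rewrite sum_ffunE (bigD1 1%g) ?group1 //= big1 => [|h /andP[_ ne1]].
  rewrite !ffunE eqxx addr0 /GRing.scale /= mulr1 => /eqP.
  by rewrite invr_eq0 (negPf (nzB _ _ Ka (group1 H))).
by rewrite !ffunE xpair_eqE eqxx (negPf ne1) scaler0.
Qed.

(* Only x in C_G(a) matters: there conjugation by x multiplies B(a, .) by the
   same factor as it multiplies the elements delta_a h. *)
Lemma bichar_vector_eigen h g x : h \in H ->
  delta a h * (delta g x * e) = B a h *: (delta a 1%g * (delta g x * e)).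
Proof.
have [nzB BM _] := bichB => Hh.
rewrite -bichar_vectorE !mulrA !deltaM conj_centralized // invg1 mul1g mulg1.
have [_|_] := eqVneq g a; last by rewrite !mul0r scaler0.
rewrite beta1l scale1r mul1g -!scalerAl !deltaM.
have -> : ((h * x)^-1 * a * (h * x) = x^-1 * a * x)%g.
  by rewrite invMg -{2}(conj_centralized Hh) !mulgA.
have [ax|_] := eqVneq a (x^-1 * a * x)%g; last first.
  by rewrite !mul0r !scaler0.
have Hx : (x^-1 * h * x)%g \in H.
  by rewrite -mulgA -/(conjg h x) memJ_norm // (subsetP (normal_norm nH)) ?inE.
have xhx : (x * (x^-1 * h * x) = h * x)%g by rewrite !mulgA mulgV mul1g.
have dhx : delta a x * delta a (x^-1 * h * x)%g
           = beta w a x (x^-1 * h * x)%g *: delta a (h * x)%g.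
  by rewrite deltaM -ax eqxx xhx.
have swap : delta a (h * x)%g
    = (beta w a x (x^-1 * h * x)%g)^-1 *: (delta a x * delta a (x^-1 * h * x)%g).
  by rewrite dhx scalerA mulVf ?scale1r ?beta_neq0.
rewrite !beta1r !scale1r !mulg1 swap -scalerAl -mulrA (delta_bichar_vector Hx).
rewrite -scalerAr !scalerA; congr (_ *: _).
(* Invariance expresses [B a (x^-1 * h * x)] through [B a h]; the leftover [beta] factors cancel by
   the cocycle identity for [h], [x], [x^-1]. *)
have := invB x Ka Hx; rewrite -ax xhx mulgK => ->.
have := beta_cocycle w a h x x^-1%g.
rewrite conj_centralized // mulgV beta1r mulr1 => <-.
move: (beta_neq0 w a h x) (beta_neq0 w a (h * x)%g x^-1%g).
move: (beta_neq0 w a x (x^-1 * h * x)%g).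
move: (beta w a h x) (beta w a (h * x)%g _) (beta w a x _) => b c d d0 b0 c0.
by field; rewrite d0 b0 c0.
Qed.

Definition DPR_regular : module D := regular_module _.

Definition bichar_ideal : {vspace DPR_regular} := span_delta <[e : DPR_regular]>%VS.

Lemma DPR_regularE (u v : D) : act DPR_regular u v = u * v.
Proof. exact: lfunE. Qed.

Lemma mem_bichar_ideal v : v \in bichar_ideal ->
  exists c : gT * gT -> k, v = \sum_p c p *: (delta p.1 p.2 * e).
Proof.
case/memv_sumP => vs Iv ->.
have ev p : {c : k | vs p = c *: (delta p.1 p.2 * e)}.
  apply: sig_eqW; have /memv_imgP[_ /vlineP[c ->] ->] := Iv p isT.
  by exists c; rewrite linearZ; congr (_ *: _); apply: DPR_regularE.
by exists (fun p => sval (ev p)); apply: eq_bigr => p _; case: (ev p).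
Qed.

Lemma bichar_ideal_eigen h v : h \in H -> v \in bichar_ideal ->
  act DPR_regular (delta a h) v = B a h *: act DPR_regular (delta a 1%g) v.
Proof.
move=> Hh /mem_bichar_ideal[c ->]; rewrite !DPR_regularE !mulr_sumr scaler_sumr.
apply: eq_bigr => p _; rewrite -!scalerAr bichar_vector_eigen //.
by rewrite !scalerA mulrC.
Qed.

(** Since [e] starts with [delta a 1], a product [delta g 1 * delta h x * e] is nonzero only if
    [h = g] and [x] conjugates [g] to [a]. *)
Lemma bichar_ideal_supp g v : (forall x, (x^-1 * g * x)%g <> a) ->
  v \in bichar_ideal -> act DPR_regular (delta g 1%g) v = 0.
Proof.
move=> nconj /mem_bichar_ideal[c ->]; rewrite DPR_regularE mulr_sumr.
apply: big1 => [[h x]] _; rewrite -scalerAr -bichar_vectorE !mulrA !deltaM.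
have [_|_] := eqVneq; last by rewrite !mul0r scaler0.
rewrite -scalerAl deltaM; have [ax|_] := eqVneq; last by rewrite scaler0 mul0r scaler0.
by case: (nconj (1 * x)%g).
Qed.

Lemma exists_bichar_module : exists M : module D,
  [/\ simple_module M, act M (delta a 1%g) <> 0
    & {in H, forall h, act M (delta a h) = B a h *: act M (delta a 1%g)}].
Proof.
have nzI : bichar_ideal <> 0%VS.
  move=> I0; case/negP: bichar_vector_neq0; rewrite -memv0 -I0.
  exact: (subvP (sub_span_delta <[e : DPR_regular]>%VS)) (memv_line _).
have [U [sU [UI simU]]] := exists_simple_submodule (span_delta_submodule _) nzI.
exists (sub_module sU); split=> // [a0|h Hh].
  (* If [delta a 1] acted as zero, so would every [delta g 1]: by conjugation when [g] is conjugate
     to [a], by the support of the ideal otherwise. Their sum is the unit. *)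
  case: (simU) => nzU _; apply: nzU; apply/eqP; rewrite -subv0; apply/subvP => u _.
  rewrite memv0 -(act1v u) DPR_oneE linear_sum sum_lfunE big1 // => g _.
  have [[x gxa]|nconj] := classic (exists x, (x^-1 * g * x)%g = a).
    by rewrite (act_delta_conj0 a0 gxa) zero_lfunE.
  apply: subvs_inj; rewrite (vsval_sub_act sU) bichar_ideal_supp ?linear0 //.
    by move=> x gxa; case: nconj; exists x.
  exact/(subvP UI)/subvsP.
apply/lfunP => u; apply: subvs_inj; rewrite scale_lfunE linearZ /=.
rewrite !(vsval_sub_act sU) bichar_ideal_eigen //.
exact/(subvP UI)/subvsP.
Qed.

End BicharacterModule.

(** * Representations of the group as modules supported at the identity *)

Section RepresentationModule.
Variables (k : fieldType) (gT : finGroupType) (w : cocycle3 k gT).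
Local Notation D := (DPR w).
Local Notation delta := (@delta k gT w).
Variables (n : nat) (rG : mx_representation k [set: gT]%G n).

(* mathcomp representations act on row vectors from the right, hence x^-1. *)
Definition rep_mx (d : D) : 'M[k]_n :=
  \sum_x ((d : twalg _) (1%g, x) : k) *: rG x^-1%g.

Lemma rep_mx_linear : linear rep_mx.
Proof.
move=> c u v; rewrite /rep_mx scaler_sumr -big_split; apply: eq_bigr => x _.
by rewrite !ffunE scalerDl scalerA.
Qed.
HB.instance Definition _ :=
  GRing.isLinear.Build k D 'M[k]_n _ rep_mx rep_mx_linear.

Lemma rep_mx_delta g x : rep_mx (delta g x) = (g == 1%g)%:R *: rG x^-1%g.
Proof.
rewrite /rep_mx (bigD1 x) //= big1 => [|y neyx].
  by rewrite ffunE xpair_eqE eqxx andbT addr0.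
by rewrite ffunE xpair_eqE (eq_sym x) (negPf neyx) andbF scale0r.
Qed.

(** Every cocycle value involved has the identity as an argument. Hence the component at the
    identity is the ordinary group algebra, and untwisted representations become modules. *)
Lemma beta_1 x y : beta w 1 x y = 1.
Proof.
by rewrite /beta !mulg1 mulgKV !mulVg !cocycle3_1l cocycle3_1r cocycle3_norm invr1 !mulr1.
Qed.

Lemma rep_mxM u v : rep_mx (u * v) = rep_mx v *m rep_mx u.
Proof.
move: u v; apply: (@bilinear_span_eq _ _ _ _ (fun p : gT * gT => delta p.1 p.2)).
- by move=> u; exists (u : twalg _); apply: DPR_sum_delta.
- by move=> u c v v'; rewrite mulrDr -scalerAr rep_mx_linear.
- by move=> v c u u'; rewrite mulrDl -scalerAl rep_mx_linear.
- by move=> u c v v'; rewrite rep_mx_linear mulmxDl -scalemxAl.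
- by move=> v c u u'; rewrite rep_mx_linear mulmxDr -scalemxAr.
move=> [g x] [h y]; rewrite deltaM !rep_mx_delta /=.
have [->|neg1] := eqVneq g 1%g; last first.
  rewrite scale0r mulmx0; case: ifP => _; last by rewrite linear0.
  by rewrite linearZ /= rep_mx_delta (negPf neg1) scale0r scaler0.
rewrite mulg1 mulVg; case: eqP => _; last by rewrite linear0 scale0r mul0mx.
by rewrite beta_1 scale1r rep_mx_delta eqxx !scale1r invMg repr_mxM ?inE.
Qed.

Lemma rep_mx1 : rep_mx 1 = 1%:M.
Proof.
rewrite DPR_oneE linear_sum (bigD1 1%g) //= big1 => [|g neg1].
  by rewrite addr0 rep_mx_delta eqxx scale1r invg1 repr_mx1.
by rewrite rep_mx_delta (negPf neg1) scale0r.
Qed.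

Definition rep_act (d : D) : 'End('rV[k]_n) := linfun (mulmxr (rep_mx d)).

Lemma rep_act_linear : linear rep_act.
Proof.
move=> c u v; apply/lfunP => x; rewrite add_lfunE scale_lfunE !lfunE /=.
by rewrite rep_mx_linear mulmxDr scalemxAr.
Qed.
HB.instance Definition _ :=
  GRing.isLinear.Build k D 'End('rV[k]_n) _ rep_act rep_act_linear.

Lemma rep_act1 : rep_act 1 = \1%VF.
Proof. by apply/lfunP => x; rewrite id_lfunE lfunE /= rep_mx1 mulmx1. Qed.

Lemma rep_actM u v : rep_act (u * v) = (rep_act u \o rep_act v)%VF.
Proof. by apply/lfunP => x; rewrite comp_lfunE !lfunE /= rep_mxM mulmxA. Qed.

Definition rep_module : module D := Module rep_act1 rep_actM.

Lemma rep_module_delta1 : act rep_module (delta 1%g 1%g) = \1%VF.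
Proof.
apply/lfunP => x; rewrite id_lfunE lfunE /= rep_mx_delta eqxx scale1r invg1.
by rewrite repr_mx1 mulmx1.
Qed.

Lemma rep_module_trace x :
  lftrace (act rep_module (delta 1%g x)) = \tr (rG x^-1%g).
Proof.
rewrite /= /rep_act lftrace_rV rep_mx_delta eqxx scale1r; congr (\tr _).
by apply/row_matrixP => i; rewrite !rowE mul_rV_lin1.
Qed.

Lemma rep_module_simple : mx_irreducible rG -> simple_module rep_module.
Proof.
case/mx_irrP => n_gt0 irrG; split=> [F0|U sU].
  have := dimvf rep_module; rewrite F0 dimv0 => e.
  (* The space of row vectors has dimension [1 * n]. *)
  by move: n_gt0; rewrite -[n]mul1n [(1 * n)%N](esym e).
have [->|nzU] := eqVneq U 0%VS; [by left | right].
(* The rows of [X] are a basis of [U], so that [U] becomes a row space to which irreducibility of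
   [rG] applies. *)
pose X := \matrix_(i < \dim U) ((vbasis U)`_i : 'rV[k]_n).
have XU (v : 'rV[k]_n) : (v <= X)%MS = (v \in U).
  apply/submxP/idP => [[c ->]|Uv].
    rewrite mulmx_sum_row rpred_sum // => i _.
    by rewrite rpredZ // rowK vbasis_mem // mem_nth ?size_tuple.
  exists (\row_i coord (vbasis U) i v).
  rewrite mulmx_sum_row {1}(coord_vbasis Uv); apply: eq_bigr => i _.
  by rewrite rowK mxE.
have modX : mxmodule rG <<X>>%MS.
  rewrite (eqmx_module _ (genmxE X)); apply/mxmoduleP => x _.
  apply/row_subP => i; rewrite row_mul XU.
  have := memv_submodule (delta 1%g x^-1%g) sU (_ : row i X \in U).
  by rewrite -XU row_sub lfunE /= rep_mx_delta eqxx scale1r invgK => /(_ isT).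
have nzX : <<X>>%MS != 0.
  apply: contra nzU; rewrite -submx0 genmxE -subv0 => X0; apply/subvP => v.
  by rewrite -XU memv0 -submx0 => vX; apply: submx_trans vX X0.
have fullX := irrG _ modX nzX.
apply/eqP; rewrite eqEsubv subvf; apply/subvP => v _.
rewrite -XU -(genmxE X); exact: submx_full.
Qed.

End RepresentationModule.

(** * Irreducible traces separate the identity *)

Section RegularTrace.
Variables (F : closedFieldType) (gT : finGroupType) (G : {group gT}).
Hypothesis charF : [pchar F] =i pred0.

(** The regular trace is a combination of irreducible traces, so it takes at [x] its value |G| at
    the identity, nonzero in characteristic zero. Off the identity the regular trace vanishes. *)
Lemma irr_trace_faithful x : x \in G ->
  (forall n (rG : mx_representation F G n), mx_irreducible rG ->
     \tr (rG x) = \tr (rG 1%g)) -> x = 1%g.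
Proof.
move=> Gx trx.
have F'G : ([pchar F]^'.-group G)%g by apply/pgroupP => p _ _; rewrite inE /= charF.
have sG : irrType F G := DecSocleType (regular_repr F G).
have splitG : group_splitting_field F G by apply: group_closure_closed_field.
have tr_reg : \tr (regular_repr F G x) = \tr (regular_repr F G 1%g).
  rewrite !(mxtrace_regular_pchar sG F'G splitG) ?group1 //.
  by apply: eq_bigr => i _; rewrite trx //; apply: socle_irr.
apply/eqP/negP => /negP nex1; move: tr_reg; rewrite repr_mx1 mxtrace1.
rewrite [LHS]big1 => [/esym/eqP|i _].
  rewrite (pcharf0P F).1 // => /eqP G0.
  by have := cardG_gt0 G; rewrite -[#|G|]/(gcard G) G0.
(* A nonzero diagonal entry would mean that right translation by [x] fixes a group element. *)
rewrite !mxE eqxx /=; case: eqP => // /(congr1 (@enum_val _ [in G])).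
rewrite gring_indexK ?groupM ?enum_valP // => /esym/eqP.
by rewrite -{2}[enum_val i]mulg1 (inj_eq (mulgI _)) (negPf nex1).
Qed.

End RegularTrace.

(** The trace of this idempotent is the dimension of its nonzero image. *)
Lemma lftrace_delta_neq0 (k : fieldType) (gT : finGroupType) (w : cocycle3 k gT)
    (M : module (DPR w)) a :
  [pchar k] =i pred0 -> act M (delta w a 1%g) <> 0 ->
  lftrace (act M (delta w a 1%g)) != 0.
Proof.
move=> chark /act_delta_neq0 nzU.
rewrite -(lftrace_onE (limg_act_delta M a 1%g)) lftrace_on_id; last exact: act_delta_id.
by rewrite (pcharf0P k).1 // dimv_eq0; apply/eqP.
Qed.

(** * The inclusion criterion *)

Theorem proposition6p1 (k : closedFieldType) (chark : [pchar k] =i pred0)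
    (gT : finGroupType) (w : cocycle3 k gT)
    (R : {set gT}) (R_repr : is_transversal R (classes [set: gT]) [set: gT])
    (K H K' H' : {group gT})
    (nK : (K <| [set: gT])%g) (nH : (H <| [set: gT])%g)
    (nK' : (K' <| [set: gT])%g) (nH' : (H' <| [set: gT])%g)
    (cKH : K \subset 'C(H)%g) (cKH' : K' \subset 'C(H')%g)
    (B B' : gT -> gT -> k)
    (bichB : omega_bichar w K H B) (invB : G_invariant w K H B)
    (bichB' : omega_bichar w K' H' B') (invB' : G_invariant w K' H' B') :
  (forall M : module (DPR w), in_S R K H B M -> in_S R K' H' B' M) <->
  [/\ K \subset K', H' \subset H & {in K & H', forall x y, B x y = B' x y}].
Proof.
have memJ (L : {group gT}) g x : (L <| [set: gT])%g ->
    ((x^-1 * g * x)%g \in L) = (g \in L).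
  by move=> nL; rewrite -mulgA -/(conjg g x) memJ_norm ?(subsetP (normal_norm nL)) ?inE.
(* For the converse, the same decomposition and labels serve for the larger subcategory. *)
split=> [sub|[sKK' sH'H eqB] M [n [N [sumM objN]]]]; last first.
  exists n, N; split=> // i; have [a [chi [KRa irr obj chiB]]] := objN i.
  exists a, chi; split=> //; first exact: subsetP (setSI _ sKK') a KRa.
  move=> h H'h; rewrite chiB ?(subsetP sH'H) // eqB //.
  by case/setIP: KRa.
have transfer M a : simple_module M -> act M (delta w a 1%g) <> 0 -> a \in K :&: R ->
    {in H, forall h, lftrace (act M (delta w a h)) = B a h * lftrace (act M (delta w a 1%g))} ->
    a \in K' /\
    {in H', forall h, lftrace (act M (delta w a h)) = B' a h * lftrace (act M (delta w a 1%g))}.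
  move=> simM nza KRa trB; have [_ Ra] := setIP KRa.
  exact: (simple_in_S R_repr cKH' simM Ra nza (sub _ (in_S_simple simM nza KRa trB))).
(* On the module built from [B], both bicharacters compute the trace of [delta a h]; the nonzero
   trace of [delta a 1] cancels. *)
have repr_case a : a \in K -> a \in R ->
    a \in K' /\ {in H', forall h, h \in H -> B a h = B' a h}.
  move=> Ka Ra; have [M [simM nza actB]] := exists_bichar_module nH cKH bichB invB Ka.
  have trB : {in H, forall h,
      lftrace (act M (delta w a h)) = B a h * lftrace (act M (delta w a 1%g))}.
    by move=> h Hh; rewrite actB // lftraceZ.
  have [|K'a trB'] := transfer M a simM nza _ trB; first by rewrite inE Ka.
  split=> // h H'h Hh; apply: (mulIf (lftrace_delta_neq0 chark nza)).
  by rewrite -trB // -trB'.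
have sKK' : K \subset K'.
  apply/subsetP => g Kg; have [x Rgx] := transversal_repr_conj g R_repr.
  by rewrite -(memJ K' g x) //; apply: (repr_case _ _ Rgx).1; rewrite memJ.
(* The identity is alone in its class, so it is its own representative. *)
have R1 : 1%g \in R.
  by have [x] := transversal_repr_conj 1%g R_repr; rewrite mulg1 mulVg.
have sH'H : H' \subset H.
  (* The inverse appears because [x] acts on [rep_module] through [x^-1]. *)
  apply/subsetP => h H'h; rewrite -groupV.
  have Nx x : x \in 'N(H)%g by rewrite (subsetP (normal_norm nH)) ?inE.
  apply: coset_idr => //.
  apply: (@irr_trace_faithful k _ ([set: gT] / H)%G chark); first by rewrite mem_quotient ?inE.
  move=> n rG irrG.
  pose rGT := morphim_repr rG (normal_norm nH).
  have simM : simple_module (rep_module w rGT).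
    by apply: rep_module_simple; apply/morphim_mx_irr.
  have trM x : lftrace (act (rep_module w rGT) (delta w 1%g x)) = \tr (rG (coset H x^-1%g)).
    exact: rep_module_trace.
  have bichar1l (L : {group gT}) C y (P : {group gT}) :
      omega_bichar w L P C -> y \in P -> C 1%g y = 1.
    case=> nzC _ CM Py; have := CM 1%g 1%g y (group1 L) (group1 L) Py.
    rewrite mulg1 beta1l mul1r -{1}[C 1%g y]mulr1 => /mulfI -> //.
    exact: nzC.
  have nz1 : act (rep_module w rGT) (delta w 1%g 1%g) <> 0.
    rewrite rep_module_delta1 => id0; case: simM => + _; apply; apply/eqP.
    rewrite -subv0; apply/subvP => v _; rewrite memv0 -[v]id_lfunE id0.
    by rewrite zero_lfunE.
  have [||_ trB'] := transfer _ _ simM nz1; first by rewrite inE R1 group1.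
    move=> y Hy; rewrite (bichar1l _ _ _ _ bichB) // mul1r !trM.
    by rewrite !coset_id ?groupV ?group1.
  have := trB' h H'h; rewrite (bichar1l _ _ _ _ bichB') // mul1r !trM => ->.
  by rewrite invg1 morph1.
(* [repr_case] covers only first arguments in [R]. Conjugating [g] into [R], and [h] along with it,
   multiplies [B] and [B'] by the same nonzero [beta] factor, by invariance. *)
split=> // g h Kg H'h; have [x Rgx] := transversal_repr_conj g R_repr.
have Kgx : (x^-1 * g * x)%g \in K by rewrite memJ.
have H'hx : (x^-1 * h * x)%g \in H' by rewrite memJ.
have := (repr_case _ Kgx Rgx).2 _ H'hx (subsetP sH'H _ H'hx).
rewrite invB ?memJ ?(subsetP sH'H) // invB' ?memJ ?(subsetP sKK') //.
rewrite !mulgA mulgV mul1g mulgK => /mulfI; apply.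
by apply: mulf_neq0; [apply: mulf_neq0|rewrite invr_eq0]; apply: beta_neq0.
Qed.
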